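(* Let $\mathcal{A}$ be a commutative associative unital real algebra of dimension $m$ with a basis $\{\boldsymbol{e}_k\}_{k=0}^{m-1}$ satisfying: 1) every $\boldsymbol{e}_k$ is invertible in $\mathcal{A}$; 2) at least one of the matrices $\Gamma^p=(\gamma_{lk}^p)_{l,k=0}^{m-1}$, $p=0,\dots,m-1$, of structure constants is non-degenerate. Fix $\tilde p$ with $\det(\gamma_{lk}^{\tilde p})\neq 0$ and fix a non-degenerate real $m\times m$ matrix $\Gamma=(\gamma_{lq})_{l,q=0}^{m-1}$ with $\gamma_{0q}=1$ for all $q$. Let $\Omega=\{\boldsymbol{z}\in\mathcal{A}^n:\rho(\boldsymbol{z})<0\}$ be a domain with boundary $\partial\Omega=\{\boldsymbol{z}\in\mathcal{A}^n:\rho(\boldsymbol{z})=0\}$, where $\rho:\mathcal{A}^n\to\mathbb{R}$ is twice continuously differentiable, with respect to its $mn$ real variables, in a neighborhood of $\partial\Omega$, and $\operatorname{grad}\rho\neq 0$ everywhere on $\partial\Omega$. Let $T_{\mathcal{A}}(\boldsymbol{w})$ denote the tangent hyperplane to $\Omega$ at $\boldsymbol{w}\in\partial\Omega$, and let the formal derivatives $\frac{\partial^2\rho}{\partial\boldsymbol{z}_i^{\boldsymbol{k}}\partial\boldsymbol{z}_j^{\boldsymbol{l}}}$ and the elements $\boldsymbol{s}_j^{\boldsymbol{l}}$ be as defined in the context. Then: (i) If $\Omega$ is locally $\mathcal{A}$-linearly convex and $T_{\mathcal{A}}(\boldsymbol{w})$ is locally supporting for $\Omega$ at every point $\boldsymbol{w}\in\partial\Omega$,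 then for every $\boldsymbol{w}\in\partial\Omega$ and every vector $\boldsymbol{s}\in T_{\mathcal{A}}(\boldsymbol{w})$ with $\|\boldsymbol{s}\|=1$, $$\sum_{i,j=1}^n\sum_{k,l=0}^{m-1}\frac{\partial^2\rho(\boldsymbol{w})}{\partial\boldsymbol{z}_i^{\boldsymbol{k}}\partial\boldsymbol{z}_j^{\boldsymbol{l}}}\,\boldsymbol{s}_j^{\boldsymbol{l}}\,\boldsymbol{s}_i^{\boldsymbol{k}}\ \ge\ 0.$$ (ii) If for every $\boldsymbol{w}\in\partial\Omega$ and every vector $\boldsymbol{s}\in T_{\mathcal{A}}(\boldsymbol{w})$ with $\|\boldsymbol{s}\|=1$, $$\sum_{i,j=1}^n\sum_{k,l=0}^{m-1}\frac{\partial^2\rho(\boldsymbol{w})}{\partial\boldsymbol{z}_i^{\boldsymbol{k}}\partial\boldsymbol{z}_j^{\boldsymbol{l}}}\,\boldsymbol{s}_j^{\boldsymbol{l}}\,\boldsymbol{s}_i^{\boldsymbol{k}}\ >\ 0,$$ then $\Omega$ is locally $\mathcal{A}$-linearly convex.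
   Context: Algebra. The structure constants $\gamma_{lk}^p\in\mathbb{R}$ of $\mathcal{A}$ are defined by $\boldsymbol{e}_l\boldsymbol{e}_k=\sum_{p=0}^{m-1}\gamma_{lk}^p\boldsymbol{e}_p$, $l,k=0,\dots,m-1$. The identity of $\mathcal{A}$ is identified with $1\in\mathbb{R}$, so real numbers are regarded as elements of $\mathcal{A}$ (the double sums in the claim are elements of $\mathcal{A}$ that are real in this sense). Write $(\eta_{kl}^{\tilde p})_{k,l=0}^{m-1}$ for the inverse of the matrix $(\gamma_{lk}^{\tilde p})$ (row index $l$, column index $k$), and $(\eta_{lp})_{l,p=0}^{m-1}=\Gamma^{-1}$. The space $\mathcal{A}^n$. It is the $n$-fold Cartesian product of $\mathcal{A}$. A point $\boldsymbol{z}=(\boldsymbol{z}_1,\dots,\boldsymbol{z}_n)\in\mathcal{A}^n$ with $\boldsymbol{z}_j=\sum_{q=0}^{m-1}x_q^j\boldsymbol{e}_q$, $x_q^j\in\mathbb{R}$, is identified with $z=(x_0^1,x_1^1,\dots,x_{m-1}^n)\in\mathbb{R}^{mn}$; $\|\boldsymbol{z}\|=\big(\sum_{j=1}^n\sum_{q=0}^{m-1}|x_q^j|^2\big)^{1/2}$. Functions on $\mathcal{A}^n$ are regarded as functions on $\mathbb{R}^{mn}$, and $\rho(\boldsymbol{w})=\rho(w)$. A domain is an open connected set in $\mathbb{R}^{mn}$; a neighborhood of a point is an open ball centered at it. Elements with bold upper index. For $\boldsymbol{s}_j=\sum_{q=0}^{m-1}s_q^j\boldsymbol{e}_q\in\mathcal{A}$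 put $\boldsymbol{s}_j^{\boldsymbol{l}}=\sum_{q=0}^{m-1}\gamma_{lq}s_q^j\boldsymbol{e}_q$, $l=0,\dots,m-1$, where $\gamma_{lq}$ are the entries of $\Gamma$ (so $\boldsymbol{s}_j^{\boldsymbol{0}}=\boldsymbol{s}_j$). Formal second derivatives. For $i,j=1,\dots,n$ and $k,l=0,\dots,m-1$, $$\frac{\partial^2\rho(\boldsymbol{w})}{\partial\boldsymbol{z}_i^{\boldsymbol{k}}\partial\boldsymbol{z}_j^{\boldsymbol{l}}}:=\sum_{p,q=0}^{m-1}\eta_{pk}\,\eta_{ql}\,\frac{\partial^2\rho(w)}{\partial x_p^i\,\partial x_q^j}\,\boldsymbol{e}_p^{-1}\boldsymbol{e}_q^{-1}\in\mathcal{A}.$$ Tangent hyperplane. A vector $\boldsymbol{s}=(\boldsymbol{s}_1,\dots,\boldsymbol{s}_n)\in\mathcal{A}^n$ belongs to $T_{\mathcal{A}}(\boldsymbol{w})$, $\boldsymbol{w}\in\partial\Omega$, if $$\sum_{j=1}^n\sum_{k,l=0}^{m-1}\eta_{kl}^{\tilde p}\,\frac{\partial\rho(w)}{\partial x_l^j}\,\boldsymbol{e}_k\,\boldsymbol{s}_j=\boldsymbol{0}.$$ Here $\boldsymbol{s}=\boldsymbol{z}-\boldsymbol{w}$; as a set of points, $T_{\mathcal{A}}(\boldsymbol{w})$ is the set of $\boldsymbol{z}\in\mathcal{A}^n$ such that the vector $\boldsymbol{s}=\boldsymbol{z}-\boldsymbol{w}$ satisfies this equation. Local $\mathcal{A}$-linear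 convexity. A domain $\Omega\subset\mathcal{A}^n$ is locally $\mathcal{A}$-linearly convex if for every $\boldsymbol{w}\in\partial\Omega$ there is $(\boldsymbol{c}_1,\dots,\boldsymbol{c}_n)\in\mathcal{A}^n\setminus\{\boldsymbol{0}\}$ such that the hyperplane $\{\boldsymbol{z}\in\mathcal{A}^n:\sum_{j=1}^n\boldsymbol{c}_j(\boldsymbol{z}_j-\boldsymbol{w}_j)=\boldsymbol{0}\}$ does not intersect $\Omega$ in some neighborhood of $\boldsymbol{w}$. Such a hyperplane is called locally supporting for $\Omega$ at $\boldsymbol{w}$. *)

(* Defs.v *)
From HB Require Import structures.
From mathcomp Require Import all_boot all_order all_algebra all_field.
From mathcomp Require Import all_classical all_reals all_analysis.

Set Implicit Arguments.
Unset Strict Implicit.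
Unset Printing Implicit Defensive.

Import Order.TTheory GRing.Theory Num.Theory.
Import numFieldNormedType.Exports.

Local Open Scope classical_set_scope.
Local Open Scope ring_scope.

(* A point (z_1, ..., z_n) of A^n is encoded by the n x m matrix of its real
   coordinates: z j q is the coefficient x_q^j of e_q in z_j.  Thus A^n is
   identified with R^(mn), with its usual topology; [elt e z j] is z_j. *)

Section CalculusOnRnm.
Variables (R : realType) (n m : nat).
Implicit Types (f : 'M[R]_(n, m) -> R) (z : 'M[R]_(n, m)).
Implicit Types (Omega U : set 'M[R]_(n, m)).

(* The norm carried by 'M[R]_(n, m) in the library is the sup norm. *)
Definition enorm z : R := Num.sqrt (\sum_(j < n) \sum_(q < m) `|z j q| ^+ 2).

(* d f / d x_q^j *)
Definition pd (j : 'I_n) (q : 'I_m) f : 'M[R]_(n, m) -> R :=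
  fun z => 'D_(delta_mx j q) f z.

Definition grad f z : 'M[R]_(n, m) := \matrix_(j, q) pd j q f z.

Definition C2_on U f : Prop := forall z, U z ->
  (forall j q, derivable f z (delta_mx j q) /\ {for z, continuous (pd j q f)})
  /\ (forall i p j q, derivable (pd j q f) z (delta_mx i p) /\
        {for z, continuous (pd i p (pd j q f))}).

Definition boundary Omega : set 'M[R]_(n, m) :=
  closure Omega `\` interior Omega.

Definition avoids_near Omega (w : 'M[R]_(n, m)) (H : set 'M[R]_(n, m)) : Prop :=
  exists2 r : R, 0 < r & forall z, enorm (z - w) < r -> H z -> ~ Omega z.

End CalculusOnRnm.

Section Algebra.
Variables (R : realType) (A : falgType R) (m n : nat) (e : m.-tuple A).
Implicit Types (c s w z : 'M[R]_(n, m)) (Omega H : set 'M[R]_(n, m)).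

(* Real numbers are elements of A through r |-> r%:A. *)
Definition real_ge0 (a : A) : Prop := exists2 r : R, 0 <= r & a = r%:A.
Definition real_gt0 (a : A) : Prop := exists2 r : R, 0 < r & a = r%:A.

Definition elt z (j : 'I_n) : A := \sum_(q < m) z j q *: tnth e q.

(* (gamma_lk^p)_{l,k}, where e_l e_k = \sum_p gamma_lk^p e_p *)
Definition struct_mx (p : 'I_m) : 'M[R]_m :=
  \matrix_(l, k) coord e p (tnth e l * tnth e k).

Definition hyperplane w c : set 'M[R]_(n, m) :=
  [set z | \sum_(j < n) elt c j * elt (z - w) j = 0].

Definition locally_supporting Omega w H : Prop :=
  (exists2 c, c != 0 & H = hyperplane w c) /\ avoids_near Omega w H.

Definition locally_linearly_convex Omega : Prop :=
  forall w, boundary Omega w ->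
  exists2 c, c != 0 & avoids_near Omega w (hyperplane w c).

Definition tangent_vectors (pt : 'I_m) (rho : 'M[R]_(n, m) -> R) w :
    set 'M[R]_(n, m) :=
  [set s | \sum_(j < n) \sum_(k < m) \sum_(l < m)
     (invmx (struct_mx pt) k l * pd j l rho w) *: (tnth e k * elt s j) = 0].

Definition tangent_hyperplane (pt : 'I_m) (rho : 'M[R]_(n, m) -> R) w :
    set 'M[R]_(n, m) :=
  [set z | tangent_vectors pt rho w (z - w)].

Variable Gamma : 'M[R]_m.

(* s_j^l with bold upper index l *)
Definition elt_up s (j : 'I_n) (l : 'I_m) : A :=
  \sum_(q < m) (Gamma l q * s j q) *: tnth e q.

(* d^2 rho / d z_i^k d z_j^l *)
Definition formal_pd2 (rho : 'M[R]_(n, m) -> R) w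
    (i : 'I_n) (k : 'I_m) (j : 'I_n) (l : 'I_m) : A :=
  \sum_(p < m) \sum_(q < m)
    (invmx Gamma p k * invmx Gamma q l * pd i p (pd j q rho) w) *:
    ((tnth e p)^-1 * (tnth e q)^-1).

Definition second_order_form (rho : 'M[R]_(n, m) -> R) w s : A :=
  \sum_(i < n) \sum_(j < n) \sum_(k < m) \sum_(l < m)
    formal_pd2 rho w i k j l * elt_up s j l * elt_up s i k.

End Algebra.

(* Main.v *)
Require Import Defs.
From HB Require Import structures.
From mathcomp Require Import all_boot all_order all_algebra all_field.
From mathcomp Require Import all_classical all_reals all_analysis.

Set Implicit Arguments.
Unset Strict Implicit.
Unset Printing Implicit Defensive.

Import Order.TTheory GRing.Theory Num.Theory.
Import numFieldNormedType.Exports.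

Local Open Scope classical_set_scope.
Local Open Scope ring_scope.

(** Two algebraic facts turn the theorem into a statement of real calculus.

    The bold upper indices and the formal derivatives undo each other: since
    the sum over k of eta_pk s_i^k is s_p^i e_p, the factors e_p^-1 cancel the
    e_p, and the form in A is the Hessian quadratic form of rho at s, times
    the unit of A ([second_order_formE]).

    The tangency equation of the hyperplane is one equation in A, that is, m
    real equations; its coordinate along the distinguished index is the
    equation of the real tangent hyperplane, because the inverse of the
    structure matrix cancels against the product of A ([tangent_dform0]).
    Hence rho has a zero first derivative at w in each direction s of the
    tangent hyperplane, and along the line w + ts it behaves like t^2/2 times
    the Hessian form at s.

    (i) If the Hessian form were negative at s, points w + ts with t small
    would lie both in Omega and in the supporting hyperplane
    ([negative_near_on_line]).

    (ii) If it is positive on all unit tangent directions at w, then by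
    compactness of the set of these directions it stays positive on them at
    all points near w, so rho >= 0 on the tangent hyperplane near w
    ([local_min_on_cone]), and the tangent hyperplane is locally supporting.

    The hypothesis on rho is about partial derivatives only, so directional
    derivatives are built from them ([is_derive_addl], [is_derive_dform]);
    Taylor's formula is replaced by two applications of the mean value theorem
    ([sign_of_second_order]). *)

(** * Derivatives along lines *)

Lemma cvg_sumr (R : numFieldType) (T : Type) (F : set_system T) (FF : Filter F)
    (I : Type) (r : seq I) (f : I -> T -> R) (l : I -> R) :
  (forall i, f i x @[x --> F] --> l i) ->
  \sum_(i <- r) f i x @[x --> F] --> \sum_(i <- r) l i.
Proof.
move=> fl; rewrite -(fct_sumE r predT f).
elim: r => [|i r IH]; first by rewrite !big_nil; exact: cvg_cst.
by rewrite !big_cons; apply: cvgD.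
Qed.

Section DerivativesAlongLines.
Variables (R : realType) (V : normedModType R).
Implicit Types (f : V -> R) (x u v : V).

Lemma is_derive_line f x u (c d : R) :
  is_derive (c *: u + x) u f d ->
  is_derive c 1 (fun t : R => f (t *: u + x)) d.
Proof.
move=> [df dE].
have E : (fun h : R => h^-1 *: (((fun t : R => f (t *: u + x)) \o shift c) (h *: 1)
             - f (c *: u + x))) =
         (fun h : R => h^-1 *: ((f \o shift (c *: u + x)) (h *: u) - f (c *: u + x))).
  apply/funext => h /=; congr (_ *: (f _ - _)).
  by rewrite scalerDl -addrA /GRing.scale/= mulr1.
by split; rewrite /derivable /derive E.
Qed.

(** The bound is on absolute values because b may be negative or zero: the mean
    value theorem is applied on [0, 1] to t |-> f (tb u + x). *)
Lemma mean_value_increment f x u (b : R) :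
  (forall t, `|t| <= `|b| -> derivable f (t *: u + x) u) ->
  exists2 t, `|t| <= `|b| & f (b *: u + x) - f x = b * 'D_u f (t *: u + x).
Proof.
move=> df.
pose g t := f (t *: u + x).
have dg (t : R) : `|t| <= `|b| -> is_derive t 1 g ('D_u f (t *: u + x)).
  by move=> tb; apply: is_derive_line; apply: derivableP; exact: df.
have tb (t : R) : t \in `[0, 1] -> `|b * t| <= `|b|.
  rewrite in_itv/= => /andP[t0 t1].
  by rewrite normrM (ger0_norm t0) ler_piMr.
have dgb (t : R) : t \in `[0, 1] ->
    is_derive t 1 (g \o *%R b) ('D_u f (b * t *: u + x) * b).
  move=> t01; apply: is_derive1_comp; first exact: dg (tb _ t01).
  apply: is_derive_eq (is_deriveZ b (is_derive_id t 1)) _.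
  by rewrite /GRing.scale/= mulr1.
have cg : {within `[0, 1], continuous (g \o *%R b)}.
  by apply: derivable_within_continuous => t /dgb dt; exact: ex_derive.
have dgb' (t : R) : t \in `]0, 1[ ->
    is_derive t 1 (g \o *%R b) ('D_u f (b * t *: u + x) * b).
  by move=> /subset_itv_oo_cc; exact: dgb.
have [t t01] := MVT_segment ler01 dgb' cg.
rewrite /= mulr0 /g scale0r add0r mulr1 subr0 mulr1 mulrC => ->.
by exists (b * t) => //; exact: tb.
Qed.

(** The step from partial to directional derivatives.  The increment of f along
    h (a u + v) is the increment along ha u, starting from x + hv, plus the
    increment along hv.  The mean value theorem turns the former into ha times
    a value of 'D_u f at a point that tends to x with h, which is why
    continuity of 'D_u f is needed for this direction and not for v. *)
Lemma is_derive_addl f x u v (a d : R) :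
  (\forall y \near x, derivable f y u) -> {for x, continuous ('D_u f)} ->
  is_derive x v f d -> is_derive x (a *: u + v) f (a * 'D_u f x + d).
Proof.
move=> df cf [dv dE].
suff cvg_quot : h^-1 *: ((f \o shift x) (h *: (a *: u + v)) - f x)
    @[h --> 0^'] --> a * 'D_u f x + d.
  by split; [apply/cvg_ex; exists (a * 'D_u f x + d)|apply/cvg_lim].
pose inc (h : R) := h^-1 *: (f ((h * a) *: u + (h *: v + x)) - f (h *: v + x)).
have -> : (fun h : R => h^-1 *: ((f \o shift x) (h *: (a *: u + v)) - f x)) =
    inc + (fun h : R => h^-1 *: ((f \o shift x) (h *: v) - f x)).
  apply/funext => h; rewrite /inc fctE/=.
  rewrite -[LHS]/(h^-1 * _) -[RHS]/(h^-1 * _ + h^-1 * _) -mulrDr addrA subrK.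
  by rewrite scalerDr scalerA addrA.
apply: cvgD; last by rewrite -dE; exact: dv.
apply/cvgrPdist_le => e e0.
have a1 : 0 < `|a| + 1 by rewrite ltr_wpDl.
have : \forall y \near x, derivable f y u /\
    `|'D_u f x - 'D_u f y| < e / (`|a| + 1).
  near=> y; split; first by near: y.
  by near: y; move/cvgrPdist_lt : cf; apply; rewrite divr_gt0.
move=> /nbhs_ballP[r /= r0 Br].
(* [C] bounds the displacement of the intermediate point per unit of [h]; the
   final [+ 1] only makes it positive. *)
pose C := `|a| * `|u| + `|v| + 1.
have C0 : 0 < C by rewrite /C ltr_wpDl// addr_ge0// mulr_ge0.
have near_line (h t : R) : `|h| < r / C -> `|t| <= `|h * a| ->
    ball x r (t *: u + (h *: v + x)).
  move=> hr th; rewrite -ball_normE /ball_/= addrA opprD addrCA subrr addr0.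
  rewrite normrN (le_lt_trans (ler_normD _ _))// !normrZ.
  apply: (@le_lt_trans _ _ (`|h| * C)); last by rewrite -ltr_pdivlMr.
  rewrite /C !mulrDr -addrA lerD//.
    by rewrite mulrA -normrM ler_wpM2r.
  by rewrite lerDl mulr1.
near=> h.
have h0 : h != 0 by near: h; exact: nbhs_dnbhs_neq.
have hr : `|h| < r / C by near: h; apply: dnbhs0_lt; rewrite divr_gt0.
have [t th incE] := @mean_value_increment f (h *: v + x) u (h * a)
  (fun t th => (Br _ (near_line h t hr th)).1).
have -> : inc h = a * 'D_u f (t *: u + (h *: v + x)).
  by rewrite /inc incE -[LHS]/(h^-1 * _) -mulrA mulKf.
rewrite -mulrBr normrM.
have := (Br _ (near_line h t hr th)).2.
rewrite ltr_pdivlMr// => /ltW; apply: le_trans.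
by rewrite mulrC ler_wpM2l// lerDl.
Unshelve. all: by end_near. Qed.

End DerivativesAlongLines.

(** By two mean values, g t - g 0 = g2 y * x * t for some 0 < y < x < t.  The
    factor [c] (1 or -1 below) treats both signs of g2 at once. *)
Lemma sign_of_second_order (R : realType) (g g1 g2 : R -> R) (c t : R) : 0 < t ->
  (forall x : R, 0 <= x <= t -> is_derive x 1 g (g1 x)) ->
  (forall x : R, 0 <= x <= t -> is_derive x 1 g1 (g2 x)) ->
  g1 0 = 0 -> (forall x : R, 0 <= x <= t -> 0 < c * g2 x) ->
  0 < c * (g t - g 0).
Proof.
move=> t0 dg dg1 g10 g2_gt0.
have MVT0 (f df : R -> R) (s : R) : 0 < s <= t ->
    (forall x : R, 0 <= x <= t -> is_derive x 1 f (df x)) ->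
    exists2 x : R, 0 < x < s & f s - f 0 = df x * s.
  move=> /andP[s0 st] dfP.
  have ins (x : R) : x \in `[0, s] -> 0 <= x <= t.
    by rewrite in_itv/= => /andP[-> /le_trans->].
  have cf : {within `[0, s], continuous f}.
    by apply: derivable_within_continuous => x /ins /dfP dx; exact: ex_derive.
  have df' (x : R) : x \in `]0, s[ -> is_derive x 1 f (df x).
    by move=> /subset_itv_oo_cc /ins; exact: dfP.
  have [x x0s] := MVT s0 df' cf.
  by rewrite subr0 => ->; exists x; rewrite ?in_itv// in x0s *.
have [|x /andP[x0 xt] ->] := MVT0 g g1 t _ dg; first by rewrite t0 lexx.
have [|y /andP[y0 yx]] := MVT0 g1 g2 x _ dg1; first by rewrite x0 ltW.
rewrite g10 subr0 => ->; rewrite !mulrA; do 2!apply: mulr_gt0 => //; apply: g2_gt0.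
by rewrite (ltW y0) (ltW (lt_trans yx xt)).
Qed.

(** * Second-order behaviour of a function with continuous second partials *)

Section SecondOrder.
Variables (R : realType) (n m : nat).
Implicit Types (f : 'M[R]_(n, m) -> R) (s w x z : 'M[R]_(n, m)).
Implicit Types (U : set 'M[R]_(n, m)).

Definition dform f z s : R := \sum_(j < n) \sum_(q < m) s j q * pd j q f z.

(** The Hessian quadratic form, written as the derivative of [dform f ^~ s] along
    [s], which is how it arises. *)
Definition hform f z s : R :=
  \sum_(j < n) \sum_(q < m) s j q * dform (pd j q f) z s.

Lemma hformE f z s : hform f z s = \sum_(i < n) \sum_(j < n) \sum_(p < m)
  \sum_(q < m) pd i p (pd j q f) z * (s i p * s j q).
Proof.
rewrite [RHS]exchange_big/=; apply: eq_bigr => j _.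
under [RHS]eq_bigr do rewrite exchange_big/=.
rewrite [RHS]exchange_big/=; apply: eq_bigr => q _.
rewrite /dform mulr_sumr; apply: eq_bigr => i _.
rewrite mulr_sumr; apply: eq_bigr => p _.
by rewrite mulrA mulrC (mulrC (s j q)).
Qed.

(** The coordinate directions are added one at a time by [is_derive_addl]. *)
Lemma is_derive_dform f x s :
  (forall j q, (\forall y \near x, derivable f y (delta_mx j q)) /\
    {for x, continuous (pd j q f)}) ->
  is_derive x s f (dform f x s).
Proof.
move=> pdf; rewrite /dform {1}(matrix_sum_delta s) !pair_bigA/=.
elim: (index_enum _) => [|[j q] r IH]; first by rewrite !big_nil; exact: is_derive0.
rewrite !big_cons/=; have [df cf] := pdf j q.
exact: is_derive_addl.
Qed.

Lemma C2_is_derive U f x s : open U -> C2_on U f -> U x ->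
  is_derive x s f (dform f x s).
Proof.
move=> Uo fC2 Ux; apply: is_derive_dform => j q; split.
  have : \forall y \near x, U y by exact: open_nbhs_nbhs.
  by apply: filterS => y /fC2[/(_ j q)[]].
by have [/(_ j q)[]] := fC2 _ Ux.
Qed.

Lemma C2_is_derive_dform U f x s : open U -> C2_on U f -> U x ->
  is_derive x s (dform f ^~ s) (hform f x s).
Proof.
move=> Uo fC2 Ux.
have -> : dform f ^~ s = \sum_(j < n) \sum_(q < m) (s j q \*: pd j q f).
  by rewrite fct_sumE; apply/funext => z; apply: eq_bigr => j _; rewrite fct_sumE.
apply: is_derive_sum => j; apply: is_derive_sum => q; apply: is_deriveZ.
apply: is_derive_dform => i p; split.
  have : \forall y \near x, U y by exact: open_nbhs_nbhs.
  by apply: filterS => y /fC2[_ /(_ i p j q)[]].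
by have [_ /(_ i p j q)[]] := fC2 _ Ux.
Qed.

(** The second-order form of Taylor's formula along a segment on which the second
    derivative keeps its sign. *)
Lemma sign_along_line U f w s (c t : R) : open U -> C2_on U f -> 0 < t ->
  (forall a, 0 <= a <= t -> U (a *: s + w)) -> dform f w s = 0 ->
  (forall a, 0 <= a <= t -> 0 < c * hform f (a *: s + w) s) ->
  0 < c * (f (t *: s + w) - f w).
Proof.
move=> Uo fC2 t0 Uline df0 hf.
have := @sign_of_second_order R (fun a => f (a *: s + w))
  (fun a => dform f (a *: s + w) s) (fun a => hform f (a *: s + w) s) c t t0.
rewrite scale0r add0r; apply => // a /Uline Ua.
  exact: (@is_derive_line _ _ f w s a _ (C2_is_derive s Uo fC2 Ua)).
exact: (@is_derive_line _ _ (dform f ^~ s) w s a _ (C2_is_derive_dform s Uo fC2 Ua)).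
Qed.

(** Joint continuity in the point and the direction, needed to move the point
    while the direction ranges over a compact set. *)
Lemma hform_continuous U f w s : C2_on U f -> U w ->
  {for (w, s), continuous (fun p : 'M[R]_(n, m) * 'M[R]_(n, m) => hform f p.1 p.2)}.
Proof.
move=> fC2 /fC2[_ cf]; rewrite /continuous_at.
have cvg_entry j q :
    (p : 'M[R]_(n, m) * 'M[R]_(n, m)).2 j q @[p --> (w, s)] --> s j q.
  apply: (cvg_comp snd (fun z : 'M[R]_(n, m) => z j q)); first exact: cvg_snd.
  exact: coord_continuous.
apply: cvg_sumr => j; apply: cvg_sumr => q; apply: cvgM; first exact: cvg_entry.
apply: cvg_sumr => i; apply: cvg_sumr => p; apply: cvgM; first exact: cvg_entry.
apply: (cvg_comp fst (pd i p (pd j q f))); first exact: cvg_fst.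
by have [] := cf i p j q.
Qed.

Lemma enorm_sq s : enorm s ^+ 2 = \sum_(j < n) \sum_(q < m) s j q ^+ 2.
Proof.
rewrite sqr_sqrtr.
  by apply: eq_bigr => j _; apply: eq_bigr => q _; rewrite real_normK ?num_real.
by apply: sumr_ge0 => j _; apply: sumr_ge0 => q _; rewrite exprn_ge0.
Qed.

Lemma enorm_ge0 s : 0 <= enorm s. Proof. exact: sqrtr_ge0. Qed.

Lemma enormZ (a : R) s : enorm (a *: s) = `|a| * enorm s.
Proof.
apply/eqP; rewrite -(@eqrXn2 _ 2) ?mulr_ge0 ?enorm_ge0// exprMn !enorm_sq.
rewrite real_normK ?num_real// mulr_sumr; apply/eqP.
apply: eq_bigr => j _; rewrite mulr_sumr; apply: eq_bigr => q _.
by rewrite mxE exprMn.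
Qed.

Lemma mx_entry_le_enorm s j q : `|s j q| <= enorm s.
Proof.
rewrite -ler_sqr ?nnegrE ?enorm_ge0// enorm_sq real_normK ?num_real//.
rewrite (bigD1 j)//= (bigD1 q)//= -addrA lerDl addr_ge0//.
  by apply: sumr_ge0 => k _; rewrite sqr_ge0.
by apply: sumr_ge0 => i _; apply: sumr_ge0 => k _; rewrite sqr_ge0.
Qed.

(** The topology is that of the sup norm; this makes Euclidean balls small. *)
Lemma mx_norm_le_enorm s : `|s| <= enorm s.
Proof.
rewrite [leLHS]/Num.Def.normr/= mx_normrE (bigmax_le _ (enorm_ge0 s))//= => -[j q] _.
exact: mx_entry_le_enorm.
Qed.

Lemma enorm_gt0 s : s != 0 -> 0 < enorm s.
Proof. by rewrite -normr_gt0 => /lt_le_trans; apply; exact: mx_norm_le_enorm. Qed.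

(** Neighborhoods of a matrix are given entrywise, and the entries of [vec_mx v]
    are those of [v], reindexed. *)
Lemma vec_mx_continuous : continuous (@vec_mx R n m).
Proof.
move=> v A [P /= vP PA].
exists (fun=> fun k => [set a | forall i j, k = mxvec_index i j -> P i j a]).
  move=> i0 k /=; rewrite (ord1 i0); case/mxvec_indexP: k => i j.
  have := vP i j; rewrite mxE; apply: filterS => a Pa i' j'.
  by move=> /cast_ord_inj /enum_rank_inj [<- <-].
by move=> u /= uP; apply: PA => i j; rewrite mxE; exact: uP.
Qed.

(** Closed bounded sets of row vectors are compact; the set of matrices is the
    continuous image under [vec_mx] of such a set. *)
Lemma unit_sphere_closedI_compact (T : set 'M[R]_(n, m)) :
  closed T -> compact (T `&` [set s | enorm s = 1]).
Proof.
move=> Tc; set K := _ `&` _.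
have entry_cts j q : continuous (fun s : 'M[R]_(n, m) => s j q) by exact: coord_continuous.
have Kc : closed K.
  apply: closedI => //.
  have -> : [set s : 'M[R]_(n, m) | enorm s = 1] =
      (fun s => \sum_(j < n) \sum_(q < m) s j q ^+ 2) @^-1` [set 1 : R].
    apply/seteqP; split=> s /=; rewrite -enorm_sq; first by move=> ->; rewrite expr1n.
    move/eqP; rewrite sqrf_eq1 => /orP[/eqP//|/eqP s1].
    by have := enorm_ge0 s; rewrite s1 ler0N1.
  apply: preimage_closed; last exact: closed_eq.
  move=> s _; do 2!apply: (@cvg_sumr _ _ (nbhs s) _) => ?.
  exact: (@cvgM _ _ (nbhs s) _ _ _ _ _ (entry_cts _ _ s) (entry_cts _ _ s)).
have -> : K = vec_mx @` (vec_mx @^-1` K).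
  apply/seteqP; split=> [s Ks|_ [v Kv <-]//].
  by exists (mxvec s) => /=; rewrite mxvecK.
apply: continuous_compact.
  by apply: continuous_subspaceT; exact: vec_mx_continuous.
apply: bounded_closed_compact; last first.
  by apply: preimage_closed => // s _; exact: vec_mx_continuous.
exists 1; split; first exact: num_real.
move=> M M1 v [_ /= v1].
rewrite [leLHS]/Num.Def.normr/= mx_normrE.
apply: bigmax_le; first exact: le_trans (ltW M1).
move=> [i k] _ /=; rewrite (ord1 i); case/mxvec_indexP: k => j q.
have := mx_entry_le_enorm (vec_mx v) j q.
by rewrite v1 mxE => /le_trans; apply; exact: ltW.
Qed.

(** [hform] is positive at (w, s) for each s in the compact set of unit vectors
    of T, hence, by joint continuity and compactness, at (x, s) for all x in one
    ball around w and all such s.  A point z of that ball with z - w in T is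
    w + ts with s a unit vector of T and t the Euclidean norm of z - w, and the
    segment from w to z stays in the ball. *)
Lemma local_min_on_cone U f w (T : set 'M[R]_(n, m)) :
  open U -> C2_on U f -> U w -> closed T ->
  (forall (a : R) s, T s -> T (a *: s)) ->
  (forall s, T s -> dform f w s = 0) ->
  (forall s, T s -> enorm s = 1 -> 0 < hform f w s) ->
  exists2 r : R, 0 < r &
    forall z, enorm (z - w) < r -> T (z - w) -> f w <= f z.
Proof.
move=> Uo fC2 Uw Tc TZ dT hT.
have /compact_near_coveringP cov := unit_sphere_closedI_compact Tc.
have hT_near : \forall x \near w, T `&` [set s | enorm s = 1] `<=` (fun s => 0 < hform f x s).
  apply: (cov _ (nbhs w) (fun x s => 0 < hform f x s)) => s [Ts s1].
  have hw : 0 < hform f w s by exact: hT.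
  have hp : \forall p \near (w, s), 0 < hform f p.1 p.2.
    exact: (cvgr_gt (hform f w s) (@hform_continuous U f w s fC2 Uw) 0 hw).
  case: hp => -[B C] [/= wB sC] BC.
  exists (C, B); first by split.
  by move=> [y x] [Cy Bx]; exact: (BC (x, y) (conj Bx Cy)).
have : \forall x \near w, U x /\
    forall s, T s -> enorm s = 1 -> 0 < hform f x s.
  have U_near : \forall x \near w, U x by exact: open_nbhs_nbhs.
  near=> x; split; first by near: x.
  by move=> s Ts s1; apply: (near hT_near x).
move=> /nbhs_ballP[r /= r0 Br]; exists r => // z zr Tz.
have [->//|] := eqVneq z w; rewrite -subr_eq0 => /enorm_gt0 t0.
set t := enorm (z - w) in zr t0; pose s := t^-1 *: (z - w).
have s1 : enorm s = 1 by rewrite enormZ gtr0_norm ?invr_gt0// mulVf ?gt_eqF.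
have Ts : T s by exact: TZ.
have -> : z = t *: s + w by rewrite scalerA mulfV ?gt_eqF// scale1r subrK.
have line a : 0 <= a <= t -> ball w r (a *: s + w).
  move=> /andP[a0 at_]; rewrite -ball_normE /ball_/= opprD addrCA subrr addr0 normrN.
  rewrite (le_lt_trans (mx_norm_le_enorm _))// enormZ s1 mulr1 ger0_norm//.
  exact: le_lt_trans zr.
rewrite -subr_ge0 ltW// -[ltRHS]mul1r.
apply: (@sign_along_line U) => //; first by move=> a /line/Br[].
  exact: dT.
by move=> a /line/Br[_ hx]; rewrite mul1r; exact: hx.
Unshelve. all: by end_near. Qed.

(** By continuity the form stays negative on a whole segment w + as, where
    [sign_along_line] applies; t is then taken below both bounds. *)
Lemma negative_near_on_line U f w s (r : R) :
  open U -> C2_on U f -> U w -> dform f w s = 0 -> hform f w s < 0 -> 0 < r ->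
  exists2 t : R, 0 < t < r & f (t *: s + w) < f w.
Proof.
move=> Uo fC2 Uw df0 hneg r0.
have line_cvg : (a *: s + w) @[a --> (0 : R)] --> w.
  have : (a *: s + w) @[a --> (0 : R)] --> 0 *: s + w.
    by apply: cvgD; [apply: cvgZr_tmp; exact: cvg_id|exact: cvg_cst].
  by rewrite scale0r add0r.
have : \forall a \near (0 : R), U (a *: s + w) /\ hform f (a *: s + w) s < 0.
  near=> a; split.
    by near: a; apply: line_cvg; exact: open_nbhs_nbhs.
  near: a.
  have : hform f (a *: s + w) s @[a --> (0 : R)] --> hform f w s.
    have pair_cvg : (a *: s + w, s) @[a --> (0 : R)] --> (w, s).
      exact: (cvg_pair line_cvg (cvg_cst s)).
    exact: (cvg_comp (fun a : R => (a *: s + w, s))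
      (fun p : 'M[R]_(n, m) * 'M[R]_(n, m) => hform f p.1 p.2) pair_cvg
      (@hform_continuous U f w s fC2 Uw)).
  by move/(cvgr_lt (hform f w s)); apply.
move=> /nbhs_ballP[d /= d0 Bd].
pose t := Num.min d r / 2.
have t0 : 0 < t by rewrite divr_gt0// lt_min d0.
have tlt : t < Num.min d r by rewrite ltr_pdivrMr// ltr_pMr ?lt_min ?d0 ?ltr1n.
exists t; first by rewrite t0 (lt_le_trans tlt)// ge_min lexx orbT.
have line a : 0 <= a <= t -> ball (0 : R) d a.
  move=> /andP[a0 at_]; rewrite -ball_normE /ball_/= sub0r normrN ger0_norm//.
  by rewrite (le_lt_trans at_)// (lt_le_trans tlt)// ge_min lexx.
rewrite -subr_lt0 -oppr_gt0 -mulN1r.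
apply: (@sign_along_line U) => //; first by move=> a /line/Bd[].
by move=> a /line/Bd[_]; rewrite mulN1r oppr_gt0.
Unshelve. all: by end_near. Qed.

End SecondOrder.

(** * The algebra: Hessian form and tangent hyperplane in real terms *)

Lemma exchange_big2 (V : nmodType) (I J K L : finType) (F : I -> J -> K -> L -> V) :
  \sum_i \sum_j \sum_k \sum_l F i j k l = \sum_k \sum_l \sum_i \sum_j F i j k l.
Proof.
rewrite pair_bigA/=; under eq_bigr do rewrite pair_bigA/=.
rewrite exchange_big/= -(pair_bigA _ (fun k l => \sum_p F p.1 p.2 k l)).
by apply: eq_bigr => k _; apply: eq_bigr => l _; rewrite pair_bigA.
Qed.

Section AlgebraIdentities.
Variables (R : realType) (A : falgType R) (m n : nat) (e : m.-tuple A).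
Implicit Types (c s w : 'M[R]_(n, m)) (rho : 'M[R]_(n, m) -> R).

(** The reason for the entries of the inverse of Gamma in the formal derivatives:
    they isolate one coordinate from the rescaled elements. *)
Lemma elt_up_inv (Gamma : 'M[R]_m) s j p : Gamma \in unitmx ->
  \sum_(k < m) invmx Gamma p k *: elt_up e Gamma s j k = s j p *: tnth e p.
Proof.
move=> Gu; under eq_bigr do rewrite scaler_sumr.
rewrite exchange_big/=.
have E q : \sum_(k < m) invmx Gamma p k *: ((Gamma k q * s j q) *: tnth e q) =
    ((p == q)%:R * s j q) *: tnth e q.
  under eq_bigr do rewrite scalerA mulrA.
  rewrite -scaler_suml -mulr_suml.
  by have /matrixP/(_ p q) := mulVmx Gu; rewrite !mxE => ->.
under eq_bigr do rewrite E.
rewrite (bigD1 p)//= eqxx mul1r big1 ?addr0// => q /negPf qp.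
by rewrite eq_sym qp mul0r scale0r.
Qed.

(** Summing over k and l first, [elt_up_inv] leaves e_p^-1 e_q^-1 s_q^j e_q s_p^i e_p
    for each p, q, in which the basis elements cancel. *)
Lemma second_order_formE (Gamma : 'M[R]_m) rho w s :
  (forall k : 'I_m, tnth e k \is a GRing.unit) ->
  Gamma \in unitmx ->
  second_order_form e Gamma rho w s = (hform rho w s)%:A.
Proof.
move=> eU Gu; rewrite /second_order_form hformE scaler_suml.
apply: eq_bigr => i _; rewrite scaler_suml; apply: eq_bigr => j _.
set H := fun p q => pd i p (pd j q rho) w.
transitivity (\sum_(k < m) \sum_(l < m) \sum_(p < m) \sum_(q < m) H p q *:
    ((tnth e p)^-1 * (tnth e q)^-1 * (invmx Gamma q l *: elt_up e Gamma s j l) *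
      (invmx Gamma p k *: elt_up e Gamma s i k))).
  apply: eq_bigr => k _; apply: eq_bigr => l _.
  rewrite !mulr_suml; apply: eq_bigr => p _; rewrite !mulr_suml.
  apply: eq_bigr => q _; rewrite -!scalerAr -!scalerAl !scalerA.
  by congr (_ *: _); rewrite -[LHS]/(_ * _ * _) mulrC mulrA.
rewrite exchange_big2 scaler_suml; apply: eq_bigr => p _.
rewrite scaler_suml; apply: eq_bigr => q _.
transitivity (H p q *: ((tnth e p)^-1 * (tnth e q)^-1 * (s j q *: tnth e q) *
    (s i p *: tnth e p))).
  rewrite -(elt_up_inv s j q Gu) -(elt_up_inv s i p Gu).
  rewrite mulr_sumr scaler_sumr; apply: eq_bigr => k _.
  rewrite mulr_sumr mulr_suml [RHS]scaler_sumr.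
  exact: eq_bigr.
rewrite -![in LHS]scalerAr -![in LHS]scalerAl -(mulrA (tnth e p)^-1) mulVr// mulr1 mulVr//.
by rewrite ![in LHS]scalerA mulrA.
Qed.

Definition pairing c s : A := \sum_(j < n) elt e c j * elt e s j.

(** Each real coordinate of the pairing is a real linear form in s, whose
    coefficients come from the matrix of structure constants for that index. *)
Lemma coord_pairing r c s :
  coord e r (pairing c s) =
  \sum_(j < n) \sum_(q < m) s j q * (c *m struct_mx e r) j q.
Proof.
rewrite /pairing linear_sum; apply: eq_bigr => j _.
under [RHS]eq_bigr do rewrite mxE mulr_sumr.
rewrite exchange_big/= mulr_suml linear_sum; apply: eq_bigr => k _.
rewrite mulr_sumr linear_sum; apply: eq_bigr => q _.
by rewrite -scalerAr -scalerAl scalerA linearZ /= mxE mulrA.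
Qed.

Lemma pairing_eq0P c s : basis_of fullv e ->
  pairing c s = 0 <-> (forall r, coord e r (pairing c s) = 0).
Proof.
move=> eB; split=> [-> r|c0]; first by rewrite linear0.
by rewrite (coord_basis eB (memvf (pairing c s))) big1// => r _; rewrite c0 scale0r.
Qed.

(** A carries no topology: closedness is read on the m real equations given by the
    coordinates. *)
Lemma closed_annihilator c : basis_of fullv e ->
  closed [set s | pairing c s = 0].
Proof.
move=> eB.
have -> : [set s | pairing c s = 0] = \bigcap_(r in setT)
    ((fun s => coord e r (pairing c s)) @^-1` [set 0 : R]).
  apply/seteqP; split=> s /=; first by move=> c0 r _ /=; rewrite c0 linear0.
  by move=> c0; apply/pairing_eq0P => // r; exact: c0.
apply: closed_bigI => r _; apply: preimage_closed; last exact: closed_eq.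
move=> s _; rewrite /continuous_at.
under eq_fun do rewrite coord_pairing.
rewrite coord_pairing.
do 2!apply: (@cvg_sumr _ _ (nbhs s) _) => ?.
exact: (@cvgM _ _ (nbhs s) _ _ _ _ _ (@coord_continuous _ _ _ _ _ s) (cvg_cst _)).
Qed.

Lemma pairingZr c s (a : R) : pairing c (a *: s) = a *: pairing c s.
Proof.
rewrite /pairing scaler_sumr; apply: eq_bigr => j _.
rewrite scalerAr; congr (_ * _); rewrite /elt scaler_sumr.
by apply: eq_bigr => q _; rewrite mxE scalerA.
Qed.

(** The coordinates of the coefficients c_1, ..., c_n for which the tangent
    hyperplane is [hyperplane w c]. *)
Definition tangent_coef (pt : 'I_m) rho w : 'M[R]_(n, m) :=
  grad rho w *m (invmx (struct_mx e pt))^T.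

Lemma tangent_vectors_sumE pt rho w s :
  \sum_(j < n) \sum_(k < m) \sum_(l < m)
     (invmx (struct_mx e pt) k l * pd j l rho w) *: (tnth e k * elt e s j) =
  pairing (tangent_coef pt rho w) s.
Proof.
apply: eq_bigr => j _; rewrite mulr_suml; apply: eq_bigr => k _.
rewrite -scaler_suml -scalerAl mxE; congr (_ *: _).
by apply: eq_bigr => l _; rewrite !mxE mulrC.
Qed.

Lemma struct_mxT r : (forall x y : A, x * y = y * x) ->
  (struct_mx e r)^T = struct_mx e r.
Proof. by move=> A_comm; apply/matrixP => k l; rewrite !mxE A_comm. Qed.

(** Commutativity of A makes the structure matrix symmetric, so that transposing
    its inverse is harmless.  In particular the coefficients vanish only with the
    gradient. *)
Lemma tangent_coefK pt rho w : (forall x y : A, x * y = y * x) ->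
  struct_mx e pt \in unitmx ->
  tangent_coef pt rho w *m struct_mx e pt = grad rho w.
Proof. by move=> A_comm Su; rewrite /tangent_coef trmx_inv struct_mxT// mulmxKV. Qed.

(** The coordinate of index [pt] of the tangency equation is grad rho . s = 0: there
    the coefficients of [coord_pairing] are those of the gradient. *)
Lemma tangent_dform0 pt rho w s : (forall x y : A, x * y = y * x) ->
  struct_mx e pt \in unitmx ->
  pairing (tangent_coef pt rho w) s = 0 -> dform rho w s = 0.
Proof.
move=> A_comm Su /(congr1 (coord e pt)); rewrite linear0 coord_pairing tangent_coefK//.
move=> E; rewrite -[RHS]E; apply: eq_bigr => j _; apply: eq_bigr => q _.
by rewrite mxE.
Qed.

End AlgebraIdentities.

(** * Local supporting by the tangent hyperplanes *)

Theorem theorem2 (R : realType) (A : falgType R)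
  (A_comm : forall x y : A, x * y = y * x)
  (m n : nat) (e : m.-tuple A)
  (e_basis : basis_of fullv e)
  (e_unit : forall k : 'I_m, tnth e k \is a GRing.unit)
  (pt : 'I_m) (pt_nondeg : \det (struct_mx e pt) != 0)
  (Gamma : 'M[R]_m) (Gamma_nondeg : \det Gamma != 0)
  (Gamma_row0 : forall l q : 'I_m, l = 0%N :> nat -> Gamma l q = 1)
  (rho : 'M[R]_(n, m) -> R) (Omega : set 'M[R]_(n, m))
  (OmegaE : Omega = [set z | rho z < 0])
  (Omega_open : open Omega) (Omega_connected : connected Omega)
  (bdE : boundary Omega = [set z | rho z = 0])
  (rho_C2 : exists U : set 'M[R]_(n, m),
     [/\ open U, boundary Omega `<=` U & C2_on U rho])
  (grad_neq0 : forall w, boundary Omega w -> grad rho w != 0) :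
  (locally_linearly_convex e Omega ->
   (forall w, boundary Omega w ->
      locally_supporting e Omega w (tangent_hyperplane e pt rho w)) ->
   forall w s, boundary Omega w -> tangent_vectors e pt rho w s ->
     enorm s = 1 -> real_ge0 (second_order_form e Gamma rho w s))
  /\
  ((forall w s, boundary Omega w -> tangent_vectors e pt rho w s ->
      enorm s = 1 -> real_gt0 (second_order_form e Gamma rho w s)) ->
   locally_linearly_convex e Omega).
Proof.
have Gu : Gamma \in unitmx by rewrite unitmxE unitfE.
have Su : struct_mx e pt \in unitmx by rewrite unitmxE unitfE.
have [U [Uo bdU C2]] := rho_C2.
have bd0 w : boundary Omega w -> rho w = 0 by rewrite bdE.
split=> [_ supp w s bw Ts s1|form_gt0 w bw].
- move: Ts; rewrite /tangent_vectors/= tangent_vectors_sumE => Ts.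
  rewrite second_order_formE//; exists (hform rho w s) => //.
  rewrite leNgt; apply/negP => hneg.
  have [_ [r r0 avoid]] := supp w bw.
  have [t /andP[t0 tr] rt] := negative_near_on_line Uo C2 (bdU w bw)
    (tangent_dform0 A_comm Su Ts) hneg r0.
  apply: (avoid (t *: s + w)).
  + by rewrite addrK enormZ s1 mulr1 gtr0_norm.
  + rewrite /tangent_hyperplane/= /tangent_vectors/= tangent_vectors_sumE.
    by rewrite addrK pairingZr Ts scaler0.
  + by rewrite OmegaE/= (lt_le_trans rt)// bd0.
- exists (tangent_coef e pt rho w).
    apply: contra_neq (grad_neq0 w bw) => c0.
    by rewrite -(tangent_coefK rho w A_comm Su) c0 mul0mx.
  have [|||r r0 rhoP] := local_min_on_cone Uo C2 (bdU w bw)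
    (closed_annihilator (c := tangent_coef e pt rho w) e_basis).
  + by move=> a s /= Ts; rewrite pairingZr Ts scaler0.
  + by move=> s Ts; exact: (tangent_dform0 A_comm Su Ts).
  + move=> s Ts s1; have [|a a0] := form_gt0 w s bw _ s1.
      by rewrite /tangent_vectors/= tangent_vectors_sumE.
    rewrite second_order_formE// => /eqP; rewrite -subr_eq0 -scalerBl.
    by rewrite scaler_eq0 oner_eq0 orbF subr_eq0 => /eqP->.
  exists r => // z zr Tz; rewrite OmegaE/=; apply/negP.
  by rewrite -leNgt -(bd0 w bw); exact: rhoP.
Qed.
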